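(* Let $Q$ be a semimedial left quasigroup and let $n\geq 1$. (i) If $\mathrm{Dis}(Q)$ is nilpotent (resp. solvable) of length $n$, then $Q$ is nilpotent (resp. solvable) of length less than or equal to $n+1$. (ii) If $Q$ is nilpotent (resp. solvable) of length $n$, then $\mathrm{Dis}(Q)$ is a nilpotent (resp. solvable) group of length less than or equal to $2n-1$.
   Context: A left quasigroup is a (nonempty) set $Q$ with binary operations $*,\backslash$ such that $x*(x\backslash y)=y=x\backslash(x*y)$; equivalently every $L_x:y\mapsto x*y$ is a bijection, and $x\backslash y=L_x^{-1}(y)$. It is semimedial if $(x*x)*(y*z)=(x*y)*(x*z)$ for all $x,y,z$. Congruences are equivalence relations compatible with $*$ and $\backslash$. $\mathrm{LMlt}(Q)=\langle L_a: a\in Q\rangle$, and $\mathrm{Dis}(Q)$ is the normal closure in $\mathrm{LMlt}(Q)$ of $\{L_aL_b^{-1}:a,b\in Q\}$. For groups, the length of nilpotence is the nilpotency class and the length of solvability is the derived length. For an algebra $A$ and congruences $\alpha,\beta,\delta$, $C(\alpha,\beta;\delta)$ means that for every $(k+1)$-ary term operation $t$, every $a\,\alpha\,b$ and all $u_1\,\beta\,v_1,\ldots,u_k\,\beta\,v_k$, $t(a,u_1,\ldots,u_k)\,\delta\,t(a,v_1,\ldots,v_k)$ implies $t(b,u_1,\ldots,u_k)\,\delta\,t(b,v_1,\ldots,v_k)$. A congruence $\alpha$ is abelian if $C(\alpha,\alpha;0_A)$ and central if $C(\alpha,1_A;0_A)$, where $0_A$ is equality and $1_A=A\times A$. $A$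 is nilpotent (resp. solvable) if there is a chain of congruences $0_A=\alpha_0\leq\ldots\leq\alpha_m=1_A$ with $\alpha_{i+1}/\alpha_i$ central (resp. abelian) in $A/\alpha_i$ for all $i$; the smallest such $m$ is the length of nilpotence (resp. solvability). *)

(* Defs.v *)
From HB Require Import structures.
From mathcomp Require Import all_boot.
From mathcomp Require Import boolp classical_sets.

Set Implicit Arguments.
Unset Strict Implicit.
Unset Printing Implicit Defensive.

Local Open Scope classical_set_scope.
Local Open Scope group_scope.

Definition least_nat (P : nat -> Prop) (n : nat) : Prop :=
  P n /\ forall m : nat, P m -> (n <= m)%N.

(** * Subgroups of possibly infinite groups *)

Section Groups.
Variable G : groupType.
Implicit Types (A H K N S : set G).

Definition is_subgroup H : Prop :=
  [/\ H 1, forall x y, H x -> H y -> H (x * y) & forall x, H x -> H x^-1].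

Definition is_normal_in H N : Prop :=
  [/\ is_subgroup N, N `<=` H & forall x g, N x -> H g -> N (x ^ g)].

Definition generated S : set G := smallest is_subgroup S.

Definition normal_closure H S : set G := smallest (is_normal_in H) S.

Definition commutator_subgroup H K : set G :=
  generated [set [~ h, k] | h in H & k in K].

(* Indexed from 0: [lower_central H 0 = derived H 0 = H]. *)
Definition lower_central H (n : nat) : set G :=
  iter n (fun K => commutator_subgroup K H) H.

Definition derived H (n : nat) : set G :=
  iter n (fun K => commutator_subgroup K K) H.

Definition group_nilpotent_length H : nat -> Prop :=
  least_nat (fun n => lower_central H n = [set 1]).

Definition group_solvable_length H : nat -> Prop :=
  least_nat (fun n => derived H n = [set 1]).

End Groups.

(** * The symmetric group of an arbitrary type *)

Record sym (T : Type) : Type := Sym {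
  sym_fun :> T -> T;
  sym_inv : T -> T;
  sym_funK : cancel sym_fun sym_inv;
  sym_invK : cancel sym_inv sym_fun
}.

Section SymGroup.
Variable T : Type.
Implicit Types f g h : sym T.

Lemma sym_eqP f g : sym_fun f = sym_fun g -> f = g.
Proof.
case: f g => [f f' fK f'K] [g g' gK g'K] /= fg.
rewrite -{}fg in gK g'K *.
have f'g' : f' = g' by apply/funext => x; rewrite -[in LHS](g'K x) fK.
rewrite -{}f'g' in gK g'K *.
by congr Sym; apply: Prop_irrelevance.
Qed.

Definition sym_one : sym T :=
  @Sym T id id (fun _ => erefl) (fun _ => erefl).

Definition sym_mul f g : sym T :=
  Sym (can_comp (sym_funK f) (sym_funK g))
      (can_comp (sym_invK g) (sym_invK f)).

Definition sym_opp f : sym T := Sym (sym_invK f) (sym_funK f).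

Lemma sym_mulA : associative sym_mul.
Proof. by move=> f g h; apply: sym_eqP. Qed.

Lemma sym_mul1 : left_id sym_one sym_mul.
Proof. by move=> f; apply: sym_eqP. Qed.

Lemma sym_mulr1 : right_id sym_one sym_mul.
Proof. by move=> f; apply: sym_eqP. Qed.

Lemma sym_mulV : left_inverse sym_one sym_opp sym_mul.
Proof. by move=> f; apply: sym_eqP; apply/funext => x; apply: sym_funK. Qed.

Lemma sym_mulrV : right_inverse sym_one sym_opp sym_mul.
Proof. by move=> f; apply: sym_eqP; apply/funext => x; apply: sym_invK. Qed.

HB.instance Definition _ := gen_eqMixin (sym T).
HB.instance Definition _ := gen_choiceMixin (sym T).
HB.instance Definition _ := isGroup.Build (sym T)
  sym_mulA sym_mul1 sym_mulr1 sym_mulV sym_mulrV.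

End SymGroup.

(** * Left quasigroups *)

HB.mixin Record Magma_isLeftQuasigroup Q of Magma Q := {
  ldiv : Q -> Q -> Q;
  mul_ldivK : forall x y : Q, x * ldiv x y = y;
  ldiv_mulK : forall x y : Q, ldiv x (x * y) = y;
  lquasigroup_inhabited : inhabited Q
}.

#[short(type="leftQuasigroupType")]
HB.structure Definition LeftQuasigroup :=
  {Q of Magma_isLeftQuasigroup Q & Magma Q}.

Notation "x \\ y" := (ldiv x y) (at level 40, left associativity) : group_scope.

Definition semimedial (Q : leftQuasigroupType) : Prop :=
  forall x y z : Q, (x * x) * (y * z) = (x * y) * (x * z).

Section Multiplications.
Variable Q : leftQuasigroupType.

Definition ltransl (x : Q) : sym Q :=
  @Sym Q (fun y => x * y) (fun y => x \\ y) (ldiv_mulK x) (mul_ldivK x).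

Definition LMlt : set (sym Q) := generated (range ltransl).

Definition Dis : set (sym Q) :=
  normal_closure LMlt [set ltransl a / ltransl b | a in setT & b in setT].

End Multiplications.

Arguments LMlt : clear implicits.
Arguments Dis : clear implicits.

(** * Congruences and quotients *)

Record congruence (Q : leftQuasigroupType) := Congruence {
  cong_rel :> Q -> Q -> Prop;
  cong_refl : forall x, cong_rel x x;
  cong_sym : forall x y, cong_rel x y -> cong_rel y x;
  cong_trans : forall x y z, cong_rel x y -> cong_rel y z -> cong_rel x z;
  cong_mul : forall x x' y y',
    cong_rel x x' -> cong_rel y y' -> cong_rel (x * y) (x' * y');
  cong_ldiv : forall x x' y y',
    cong_rel x x' -> cong_rel y y' -> cong_rel (x \\ y) (x' \\ y')
}.

Section Quotient.
Variables (Q : leftQuasigroupType) (al : congruence Q).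
Local Open Scope quotient_scope.

Definition cong_relb (x y : {classic Q}) : bool := `[< al x y >].

Lemma cong_relb_refl : reflexive cong_relb.
Proof. by move=> x; apply/asboolP; apply: cong_refl. Qed.

Lemma cong_relb_sym : symmetric cong_relb.
Proof. by move=> x y; apply/asboolP/asboolP; apply: cong_sym. Qed.

Lemma cong_relb_trans : transitive cong_relb.
Proof.
by move=> y x z /asboolP xy /asboolP yz; apply/asboolP; apply: cong_trans yz.
Qed.

Canonical cong_equiv :=
  EquivRel cong_relb cong_relb_refl cong_relb_sym cong_relb_trans.

Definition quotient : Type := {eq_quot cong_equiv}.
HB.instance Definition _ := Choice.on quotient.
HB.instance Definition _ := EqQuotient.on quotient.

Definition qclass (x : Q) : quotient := \pi_quotient (x : {classic Q}).
Definition qrepr (X : quotient) : Q := repr X.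

Lemma qreprK : cancel qrepr qclass.
Proof. exact: reprK. Qed.

Lemma qclassP (x y : Q) : qclass x = qclass y <-> al x y.
Proof.
split; first by move=> /eqmodP /asboolP.
by move=> xy; apply/eqmodP/asboolP.
Qed.

Lemma qrepr_class (x : Q) : al (qrepr (qclass x)) x.
Proof. by apply/qclassP; rewrite qreprK. Qed.

Definition quot_mul (X Y : quotient) : quotient :=
  qclass (qrepr X * qrepr Y).

HB.instance Definition _ := hasMul.Build quotient quot_mul.

Definition quot_ldiv (X Y : quotient) : quotient :=
  qclass (qrepr X \\ qrepr Y).

Lemma quot_mul_ldivK (X Y : quotient) : X * quot_ldiv X Y = Y.
Proof.
rewrite -[RHS]qreprK; apply/qclassP.
rewrite -[X in al _ X](mul_ldivK (qrepr X) (qrepr Y)).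
by apply: cong_mul (cong_refl _ _) (qrepr_class _).
Qed.

Lemma quot_ldiv_mulK (X Y : quotient) : quot_ldiv X (X * Y) = Y.
Proof.
rewrite -[RHS]qreprK; apply/qclassP.
rewrite -[X in al _ X](ldiv_mulK (qrepr X) (qrepr Y)).
by apply: cong_ldiv (cong_refl _ _) (qrepr_class _).
Qed.

Lemma quot_inhabited : inhabited quotient.
Proof. by case: (@lquasigroup_inhabited Q) => x; exists; apply: qclass. Qed.

HB.instance Definition _ := Magma_isLeftQuasigroup.Build quotient
  quot_mul_ldivK quot_ldiv_mulK quot_inhabited.

Lemma qclass_mul (x y : Q) : qclass (x * y) = qclass x * qclass y.
Proof.
by apply/qclassP; apply: cong_sym; apply: cong_mul; apply: qrepr_class.
Qed.

Lemma qclass_ldiv (x y : Q) : qclass (x \\ y) = qclass x \\ qclass y.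
Proof.
by apply/qclassP; apply: cong_sym; apply: cong_ldiv; apply: qrepr_class.
Qed.

(* [be / al], meant for [al] contained in [be]. *)
Definition quot_rel (be : congruence Q) (X Y : quotient) : Prop :=
  exists x y : Q, [/\ X = qclass x, Y = qclass y & be x y].

End Quotient.

(** * Terms and the term condition *)

Inductive lq_term (k : nat) : Type :=
  | TVar of 'I_k
  | TMul of lq_term k & lq_term k
  | TLdiv of lq_term k & lq_term k.

Section TermCondition.
Variable Q : leftQuasigroupType.

Fixpoint eval_term k (e : 'I_k -> Q) (t : lq_term k) : Q :=
  match t with
  | TVar i => e i
  | TMul t1 t2 => eval_term e t1 * eval_term e t2
  | TLdiv t1 t2 => eval_term e t1 \\ eval_term e t2
  end.

(* The tuple [(a, u_1, ..., u_k)]. *)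
Definition cons_env k (a : Q) (u : 'I_k -> Q) (i : 'I_k.+1) : Q :=
  if unlift ord0 i is Some j then u j else a.

Definition centralizes (al be de : Q -> Q -> Prop) : Prop :=
  forall (k : nat) (t : lq_term k.+1) (a b : Q) (u v : 'I_k -> Q),
    al a b -> (forall i, be (u i) (v i)) ->
    de (eval_term (cons_env a u) t) (eval_term (cons_env a v) t) ->
    de (eval_term (cons_env b u) t) (eval_term (cons_env b v) t).

Definition abelian_cong (al : Q -> Q -> Prop) : Prop :=
  centralizes al al eq.

Definition central_cong (al : Q -> Q -> Prop) : Prop :=
  centralizes al (fun _ _ => True) eq.

End TermCondition.

(** * Nilpotence and solvability of left quasigroups *)

Section Lengths.
Variable Q : leftQuasigroupType.

(* Only [al 0, ..., al m] matter. *)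
Definition cong_chain (P : forall R : leftQuasigroupType, (R -> R -> Prop) -> Prop)
    (m : nat) : Prop :=
  exists al : nat -> congruence Q,
    [/\ forall x y, al 0%N x y <-> x = y,
        forall x y, al m x y,
        forall i, (i < m)%N -> forall x y, al i x y -> al i.+1 x y
      & forall i, (i < m)%N ->
          P (quotient (al i)) (@quot_rel Q (al i) (al i.+1))].

Definition lq_nilpotent_length : nat -> Prop :=
  least_nat (cong_chain central_cong).

Definition lq_solvable_length : nat -> Prop :=
  least_nat (cong_chain abelian_cong).

End Lengths.

Arguments lq_nilpotent_length : clear implicits.
Arguments lq_solvable_length : clear implicits.

(* Main.v *)
Require Import Defs.
From mathcomp Require Import all_boot.
From mathcomp Require Import boolp classical_sets.

(** Semimediality reads [L_(x*y) L_x = L_(x*x) L_y], so sending [L_x] to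
    [L_(x*x)] extends to an endomorphism [h |-> h'] of [LMlt Q], characterised by
    [L_(h y) h = h' L_y] for all [y]. The orbits of a normal subgroup [N] stable
    under it form a congruence, and [h x * g y = (h' L_x (h^-1 g) L_x^-1) (x * y)]:
    if conjugation by [L_x] on [N] depends, modulo [M], only on the [be]-class of
    [x], then the orbits of [N] centralize [be] modulo the orbits of [M]. The
    orbits of the lower central or derived series of [Dis Q] thus give (i); the
    extra step is the quotient by the orbits of [Dis Q], where [x * y] depends on
    [y] only.

    For (ii), let [D_al] be the normal closure of the [L_x L_y^-1] with [al x y]
    and [K_al] the subgroup of [Dis Q] acting trivially modulo [al]. The term
    condition for [x \\ h (x * z)] gives [[D_al, D_be] <= K_de] whenever [al]
    centralizes [be] modulo [de], and the endomorphism above gives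
    [[K_al, Dis Q] <= D_al]. *)

Set Implicit Arguments.
Unset Strict Implicit.
Unset Printing Implicit Defensive.

Local Open Scope classical_set_scope.
Local Open Scope group_scope.

(** * Subgroups, normal closures and commutators *)

Section Subgroups.
Variable G : groupType.
Implicit Types (H K N S : set G).

Lemma generated_subgroup S : is_subgroup (generated S).
Proof.
split=> [A AS|x y Sx Sy A AS|x Sx A AS]; first by have [] := AS.1.
  by have [_ AM _] := AS.1; exact: AM (Sx _ AS) (Sy _ AS).
by have [_ _ AV] := AS.1; exact: AV (Sx _ AS).
Qed.

Lemma subgroup_normal H : is_subgroup H -> is_normal_in H H.
Proof.
move=> Hgrp; split=> // x g Hx Hg; have [_ HM HV] := Hgrp.
by rewrite conjgE; apply: HM (HV _ Hg) (HM _ _ Hx Hg).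
Qed.

Lemma normal_closure_normal H S :
  is_subgroup H -> S `<=` H -> is_normal_in H (normal_closure H S).
Proof.
move=> Hgrp SH; split=> [||x g Sx Hg A AS].
- split=> [A AS|x y Sx Sy A AS|x Sx A AS]; first by have [[]] := AS.1.
    by have [[_ AM _] _ _] := AS.1; exact: AM (Sx _ AS) (Sy _ AS).
  by have [[_ _ AV] _ _] := AS.1; exact: AV (Sx _ AS).
- exact: smallest_sub (subgroup_normal Hgrp) SH.
- by have [_ _ AJ] := AS.1; exact: AJ (Sx _ AS) Hg.
Qed.

Lemma mem_commutator H K h k : H h -> K k -> commutator_subgroup H K [~ h, k].
Proof. by move=> Hh Kk; apply: sub_gen_smallest; exists h => //; exists k. Qed.

Lemma commutator_sub H K N : is_subgroup N ->
  (forall h k, H h -> K k -> N [~ h, k]) -> commutator_subgroup H K `<=` N.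
Proof.
move=> Ngrp HKN; apply: smallest_sub => // _ [h Hh [k Kk <-]].
exact: HKN.
Qed.

Lemma commutator_normal H K1 K2 : is_normal_in H K1 -> is_normal_in H K2 ->
  is_normal_in H (commutator_subgroup K1 K2).
Proof.
move=> [K1grp K1H K1J] [K2grp K2H K2J]; have [_ K1M K1V] := K1grp.
have Cgrp := generated_subgroup [set [~ h, k] | h in K1 & k in K2].
split=> [//||x g Cx Hg].
  apply: subset_trans K1H; apply: commutator_sub => // h k K1h K2k.
  by rewrite commgEl; apply: K1M (K1V _ K1h) (K1J _ _ K1h (K2H _ K2k)).
have [C1 CM CV] := Cgrp.
suff: commutator_subgroup K1 K2 `<=`
  [set x | commutator_subgroup K1 K2 (x ^ g)] by apply.
apply: commutator_sub => [|h k K1h K2k] /=.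
  split=> [|y z Cy Cz|y Cy] /=; first by rewrite conj1g.
    by rewrite conjMg; apply: CM.
  by rewrite conjVg; apply: CV.
by rewrite conjRg; apply: mem_commutator; [apply: K1J|apply: K2J].
Qed.

(** The [x] in [H] with [[~ x, k]] in [N] for all [k] in [K] form a normal subgroup of [H], so it
    suffices to test [S]. This reduces commutators with displacement groups to generators
    [L x / L y]. *)
Lemma commutator_normal_closure_sub H S K N h k :
  is_subgroup H -> S `<=` H -> is_normal_in H K -> is_normal_in H N ->
  (forall s k, S s -> K k -> N [~ s, k]) ->
  normal_closure H S h -> K k -> N [~ h, k].
Proof.
move=> Hgrp SH [_ KH KJ] [[N1 NM NV] _ NJ] SKN Sh Kk.
have [H1 HM HV] := Hgrp.
suff: normal_closure H S `<=`
  [set x | H x /\ forall k, K k -> N [~ x, k]] by move=> /(_ _ Sh)[_]; apply.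
move=> {h k Sh Kk}; apply: smallest_sub => [|s Ss]; last by split; [apply: SH|move=> ?; apply: SKN].
split=> [|x []//|x g [Hx Nx] Hg].
  split=> [|x y [Hx Nx] [Hy Ny]|x [Hx Nx]].
  - by split=> // k Kk; rewrite comm1g.
  - split=> [|k Kk]; first exact: HM.
    have -> : [~ x * y, k] = [~ x, k] ^ y * [~ y, k].
      by rewrite !commgEr conjgM (conjMg _ k) [k^-1 ^ y]conjVg -[RHS]mulgA mulVKg.
    by apply: NM (NJ _ _ (Nx _ Kk) Hy) (Ny _ Kk).
  - split=> [|k Kk]; first exact: HV.
    have -> : [~ x^-1, k] = ([~ x, k]^-1) ^ x^-1.
      by rewrite invgR commgEr commgEl conjMg -conjgM mulgV conjg1.
    by apply: NJ (NV _ (Nx _ Kk)) (HV _ Hx).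
split=> [|k Kk]; first by have [_ _] := subgroup_normal Hgrp; apply.
have -> : [~ x ^ g, k] = [~ x, k ^ g^-1] ^ g by rewrite conjRg conjgKV.
by apply: NJ => //; apply/Nx/KJ => //; apply: HV.
Qed.

End Subgroups.

(** Lengths are minima, so one series or chain of size [n] is enough to bound a length by [n]. *)
Lemma least_nat_exists (P : nat -> Prop) n :
  P n -> exists2 m, (m <= n)%N & least_nat P m.
Proof.
move=> Pn; have exP : exists m, `[< P m >] by exists n; apply/asboolP.
have [m /asboolP Pm min_m] := ex_minnP exP.
by exists m; [apply/min_m/asboolP|split=> // k Pk; apply/min_m/asboolP].
Qed.

(** * Displacement groups and kernels of congruences *)

Section Displacements.
Variable Q : leftQuasigroupType.
Implicit Types (g h : sym Q) (x y z : Q) (N M : set (sym Q)).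
Implicit Types (al be de : congruence Q).

Local Notation L := (@ltransl Q).

Lemma LMlt_subgroup : is_subgroup (LMlt Q).
Proof. exact: generated_subgroup. Qed.

Lemma LMlt_ltransl x : LMlt Q (L x).
Proof. by apply: sub_gen_smallest; exists x. Qed.

Lemma LMlt_ltransl_div x y : LMlt Q (L x / L y).
Proof.
have [_ GM GV] := LMlt_subgroup.
by apply: GM; [|apply: GV]; apply: LMlt_ltransl.
Qed.

(** A bare relation is taken, so that congruences and the total relation, which gives [Dis Q], are
    treated alike. *)
Definition Dis_of (R : Q -> Q -> Prop) : set (sym Q) :=
  normal_closure (LMlt Q) [set h | exists x y, R x y /\ h = L x / L y].

Lemma Dis_of_normal R : is_normal_in (LMlt Q) (Dis_of R).
Proof.
apply: normal_closure_normal LMlt_subgroup _.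
by move=> _ [x [y [_ ->]]]; apply: LMlt_ltransl_div.
Qed.

Lemma mem_Dis_of (R : Q -> Q -> Prop) x y : R x y -> Dis_of R (L x / L y).
Proof. by move=> Rxy; apply: sub_gen_smallest; exists x, y. Qed.

Lemma Dis_total : Dis Q = Dis_of (fun _ _ => True).
Proof.
rewrite /Dis /Dis_of; congr normal_closure; apply/seteqP; split=> h.
  by move=> [x _ [y _ <-]]; exists x, y.
by move=> [x [y [_ ->]]]; exists x => //; exists y.
Qed.

Lemma Dis_normal : is_normal_in (LMlt Q) (Dis Q).
Proof. by rewrite Dis_total; apply: Dis_of_normal. Qed.

Lemma Dis_ltransl_divl x y : Dis Q ((L x)^-1 * L y).
Proof.
have [_ _ DJ] := Dis_normal.
have -> : (L x)^-1 * L y = (L y / L x) ^ L x by rewrite conjgE divgK.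
by apply: DJ (LMlt_ltransl x); rewrite Dis_total; apply: mem_Dis_of.
Qed.

Lemma cong_LMlt al h x y : LMlt Q h -> al x y -> al (h x) (h y).
Proof.
move=> Gh; suff [] : (forall x y, al x y -> al (h x) (h y)) /\
  (forall x y, al x y -> al (h^-1 x) (h^-1 y)) by move=> + _; apply.
move: h Gh {x y}; apply: smallest_sub.
  split=> [//|g h [g1 g2] [h1 h2]|g [g1 g2]]; split=> x y xy.
  - exact/g1/h1.
  - by rewrite invgM; apply/h2/g2.
  - exact: g2.
  - by rewrite invgK; apply: g1.
move=> _ [z _ <-]; split=> x y xy.
  exact: cong_mul (cong_refl _ _) xy.
exact: cong_ldiv (cong_refl _ _) xy.
Qed.

Definition cong_kernel al : set (sym Q) :=
  [set h | Dis Q h /\ forall x, al (h x) x].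

Lemma cong_kernel_normal al : is_normal_in (LMlt Q) (cong_kernel al).
Proof.
have [[D1 DM DV] DG DJ] := Dis_normal.
split=> [|h [Dh _]|h g [Dh hal] Gg]; last 2 first.
- exact: DG.
- split=> [|x]; first exact: DJ.
  rewrite -[X in al _ X](sym_funK g).
  have [_ _ GV] := LMlt_subgroup.
  exact: (cong_LMlt (GV _ Gg) (hal (g x))).
split=> [|g h [Dg gal] [Dh hal]|h [Dh hal]].
- by split=> // x; apply: cong_refl.
- split=> [|x]; first exact: DM.
  exact: cong_trans (gal (h x)) (hal x).
- split=> [|x]; first exact: DV.
  by apply: cong_sym; rewrite -[X in al X _](sym_invK h); apply: hal.
Qed.

(** A generator sends [z = y * (y \\ z)] to [x * (y \\ z)], and [al x y] holds. *)
Lemma Dis_of_kernel al : Dis_of al `<=` cong_kernel al.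
Proof.
apply: smallest_sub; first exact: cong_kernel_normal.
move=> _ [x [y [xy ->]]]; split=> [|z].
  by rewrite Dis_total; apply: mem_Dis_of.
rewrite -[X in al _ X](mul_ldivK y).
exact: cong_mul xy (cong_refl _ _).
Qed.

Lemma cong_kernel_eq al : (forall x y, al x y <-> x = y) ->
  cong_kernel al = [set 1].
Proof.
move=> al0; apply/seteqP; split=> [h [_ hal]|_ ->].
  by apply: sym_eqP; apply/funext => x; apply/al0/hal.
by have [[]] := cong_kernel_normal al.
Qed.

(** * Polynomial pairs and commutators of displacement groups *)

(* Pairs of unary polynomial functions that arise from one term by choosing its
   parameters in two [R]-related ways. *)
Inductive poly_pair (R : Q -> Q -> Prop) : (Q -> Q) -> (Q -> Q) -> Prop :=
  | PVar : poly_pair R id id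
  | PConst u v of R u v : poly_pair R (fun=> u) (fun=> v)
  | PMul (f f' g g' : Q -> Q) of poly_pair R f f' & poly_pair R g g' :
      poly_pair R (fun x => f x * g x) (fun x => f' x * g' x)
  | PLdiv (f f' g g' : Q -> Q) of poly_pair R f f' & poly_pair R g g' :
      poly_pair R (fun x => f x \\ g x) (fun x => f' x \\ g' x).

Fixpoint subst_term j k (r : 'I_j -> 'I_k) (t : lq_term j) : lq_term k :=
  match t with
  | TVar i => TVar (r i)
  | TMul t1 t2 => TMul (subst_term r t1) (subst_term r t2)
  | TLdiv t1 t2 => TLdiv (subst_term r t1) (subst_term r t2)
  end.

Lemma eval_subst_term j k (r : 'I_j -> 'I_k) (e : 'I_k -> Q) t :
  eval_term e (subst_term r t) = eval_term (e \o r) t.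
Proof. by elim: t => //= [t1 -> t2 ->|t1 -> t2 ->]. Qed.

Lemma cons_env_ord0 k x (u : 'I_k -> Q) : cons_env x u ord0 = x.
Proof. by rewrite /cons_env unlift_none. Qed.

Lemma cons_env_lift k x (u : 'I_k -> Q) i : cons_env x u (lift ord0 i) = u i.
Proof. by rewrite /cons_env liftK. Qed.

Definition cat_env j k (u : 'I_j -> Q) (v : 'I_k -> Q) (i : 'I_(j + k)) : Q :=
  match split i with inl i1 => u i1 | inr i2 => v i2 end.

Definition ord0_lift j k (r : 'I_j -> 'I_k) (i : 'I_j.+1) : 'I_k.+1 :=
  if unlift ord0 i is Some i' then lift ord0 (r i') else ord0.

Lemma cons_env_catl j k x (u : 'I_j -> Q) (v : 'I_k -> Q) :
  cons_env x (cat_env u v) \o ord0_lift (lshift k) = cons_env x u.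
Proof.
apply/funext => i /=; rewrite /ord0_lift.
case: unliftP => [i'|] ->; last by rewrite !cons_env_ord0.
by rewrite !cons_env_lift /cat_env (unsplitK (inl i')).
Qed.

Lemma cons_env_catr j k x (u : 'I_j -> Q) (v : 'I_k -> Q) :
  cons_env x (cat_env u v) \o ord0_lift (@rshift j k) = cons_env x v.
Proof.
apply/funext => i /=; rewrite /ord0_lift.
case: unliftP => [i'|] ->; last by rewrite !cons_env_ord0.
by rewrite !cons_env_lift /cat_env (unsplitK (inr i')).
Qed.

(** In the binary cases each subterm brings its own parameters; these are concatenated, while the
    common variable keeps index 0. *)
Lemma poly_pair_term R f f' : poly_pair R f f' ->
  exists k (t : lq_term k.+1) (u v : 'I_k -> Q), (forall i, R (u i) (v i)) /\
    forall x, f x = eval_term (cons_env x u) t /\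
              f' x = eval_term (cons_env x v) t.
Proof.
have cat_rel j k (u v : 'I_j -> Q) (u' v' : 'I_k -> Q) :
    (forall i, R (u i) (v i)) -> (forall i, R (u' i) (v' i)) ->
    forall i, R (cat_env u u' i) (cat_env v v' i).
  by move=> uv uv' i; rewrite /cat_env; case: split.
elim=> {f f'}.
- exists 0%N, (TVar ord0), (ffun0 (card_ord 0)), (ffun0 (card_ord 0)).
  by split=> [[]//|x] /=; rewrite !cons_env_ord0.
- move=> u v uv; exists 1%N, (TVar (lift ord0 ord0)), (fun=> u), (fun=> v).
  by split=> //= x; rewrite !cons_env_lift.
- move=> f f' g g' _ [j [s [u [v [uv fs]]]]] _ [k [t [u' [v' [uv' gt]]]]].
  exists (j + k)%N, (TMul (subst_term (ord0_lift (lshift k)) s)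
    (subst_term (ord0_lift (@rshift j k)) t)), (cat_env u u'), (cat_env v v').
  split=> [|x]; first exact: cat_rel.
  have [-> ->] := fs x; have [-> ->] := gt x.
  by rewrite /= !eval_subst_term !cons_env_catl !cons_env_catr.
- move=> f f' g g' _ [j [s [u [v [uv fs]]]]] _ [k [t [u' [v' [uv' gt]]]]].
  exists (j + k)%N, (TLdiv (subst_term (ord0_lift (lshift k)) s)
    (subst_term (ord0_lift (@rshift j k)) t)), (cat_env u u'), (cat_env v v').
  split=> [|x]; first exact: cat_rel.
  have [-> ->] := fs x; have [-> ->] := gt x.
  by rewrite /= !eval_subst_term !cons_env_catl !cons_env_catr.
Qed.

Lemma centralizes_poly_pair (A R D : Q -> Q -> Prop) f f' x y :
  centralizes A R D -> poly_pair R f f' -> A x y ->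
  D (f x) (f' x) -> D (f y) (f' y).
Proof.
move=> ARD /poly_pair_term[k [t [u [v [uv ft]]]]] xy.
have [-> ->] := ft x; have [-> ->] := ft y.
exact: ARD.
Qed.

Lemma poly_pair_LMlt (R : Q -> Q -> Prop) h f f' : (forall x, R x x) ->
  LMlt Q h -> poly_pair R f f' -> poly_pair R (h \o f) (h \o f').
Proof.
move=> Rxx Gh; suff [] : (forall f f', poly_pair R f f' ->
    poly_pair R (h \o f) (h \o f')) /\ (forall f f', poly_pair R f f' ->
    poly_pair R (h^-1 \o f) (h^-1 \o f')) by move=> + _; apply.
move: h Gh {f f'}; apply: smallest_sub.
  split=> [//|g h [g1 g2] [h1 h2]|g [g1 g2]]; split=> f f' ff'.
  - exact: (g1 _ _ (h1 _ _ ff')).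
  - by rewrite invgM; apply: (h2 _ _ (g2 _ _ ff')).
  - exact: g2.
  - by rewrite invgK; apply: g1.
move=> _ [z _ <-]; split=> f f' ff'.
  exact: (PMul (PConst (Rxx z)) ff').
exact: (PLdiv (PConst (Rxx z)) ff').
Qed.

(** For [h = L x / L y], compare [x * (y \\ f t)] with [y * (y \\ f' t) = f' t]: the same
    operations, with one parameter changed from [x] to [y]. For a conjugate [h ^ g], write [f'] as
    [g^-1 \o (g \o f')]. *)
Lemma poly_pair_Dis (R : Q -> Q -> Prop) h f f' : (forall x, R x x) ->
  Dis_of R h -> poly_pair R f f' -> poly_pair R (h \o f) f'.
Proof.
move=> Rxx Dh.
have [G1 GM GV] := LMlt_subgroup.
suff [_ []] : LMlt Q h /\ (forall f f', poly_pair R f f' ->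
    poly_pair R (h \o f) f') /\ (forall f f', poly_pair R f f' ->
    poly_pair R (h^-1 \o f) f') by move=> + _; apply.
move: h Dh {f f'}; apply: smallest_sub.
  split=> [|h []//|h g [Gh [h1 h2]] Gg].
    split=> [|g h [Gg [g1 g2]] [Gh [h1 h2]]|g [Gg [g1 g2]]].
    - by split=> //; split=> f f' ff'.
    - split; first exact: GM; split=> f f' ff'.
        exact: (g1 _ _ (h1 _ _ ff')).
      by rewrite invgM; apply: (h2 _ _ (g2 _ _ ff')).
    - split; first exact: GV; split=> f f' ff'; first exact: g2.
      by rewrite invgK; apply: g1.
  have GgV := GV _ Gg.
  split; first by rewrite conjgE; exact: GM GgV (GM _ _ Gh Gg).
  have gK f' : g^-1 \o (g \o f') = f' by apply/funext => x; apply: sym_funK.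
  split=> f f' ff'; rewrite -?conjVg -[f']gK.
    exact: (poly_pair_LMlt Rxx GgV (h1 _ _ (poly_pair_LMlt Rxx Gg ff'))).
  exact: (poly_pair_LMlt Rxx GgV (h2 _ _ (poly_pair_LMlt Rxx Gg ff'))).
move=> _ [x [y [xy ->]]]; split; first exact: LMlt_ltransl_div.
have LK z (f' : Q -> Q) : (fun t => z * (z \\ f' t)) = f'.
  by apply/funext => t; apply: mul_ldivK.
split=> f f' ff'.
  rewrite -[f'](LK y).
  exact: (PMul (PConst xy) (PLdiv (PConst (Rxx y)) ff')).
rewrite -[f'](LK y) invgF.
exact: (PMul (PConst (Rxx y)) (PLdiv (PConst xy) ff')).
Qed.


(** It suffices to treat a generator [a = L x / L y] with [al x y] against [h] in [Dis_of be]. The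
    term condition shows that [y \\ h (y * z)] and [x \\ h (x * z)] agree modulo [de], which says
    that [a] and [h] commute modulo [de]. *)
Lemma centralizes_commutator al be de h g :
  centralizes al be de -> Dis_of al h -> Dis_of be g -> cong_kernel de [~ h, g].
Proof.
move=> abd; have [_ _ KJ] := cong_kernel_normal de.
apply: (commutator_normal_closure_sub LMlt_subgroup _ (Dis_of_normal be)
  (cong_kernel_normal de)).
  by move=> _ [x [y [_ ->]]]; apply: LMlt_ltransl_div.
move=> {h g} _ h [x [y [xy ->]]] Dh.
have [[D1 DM DV] DG DJ] := Dis_normal.
have [Qh _] := Dis_of_kernel Dh.
have [_ _ BJ] := Dis_of_normal be.
have hde z : de (y \\ h (y * z)) (x \\ h (x * z)).
  have zw : be z (x \\ h (x * z)).
    have [_] := Dis_of_kernel (BJ _ _ Dh (LMlt_ltransl x)).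
    by move/(_ z); apply: cong_sym.
  (* With [w = x \\ h (x * z)], the two functions agree at [t = x], both being [w]; the term
     condition carries this to [t = y], where the second one is still [w]. *)
  have pp : poly_pair be (fun t => t \\ h (t * z))
      (fun t => t \\ (t * (x \\ h (x * z)))).
    apply: (PLdiv (PVar _)).
    exact: (poly_pair_Dis (@cong_refl _ be) Dh (PMul (PVar _) (PConst zw))).
  have := centralizes_poly_pair abd pp xy.
  by rewrite !ldiv_mulK; apply; apply: cong_refl.
set a := L x / L y.
have Da : Dis Q a by rewrite Dis_total; apply: mem_Dis_of.
have [_ GM GV] := LMlt_subgroup.
split=> [|z]; first by rewrite commgEl; apply: DM (DV _ Da) (DJ _ _ Da (DG _ Qh)).
(* Multiplying [hde] at [y \\ z] by [x] on the left gives the two products; then [[~ a, h] = (h *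
   a)^-1 * (a * h)]. *)
have aha : de ((a * h) z) ((h * a) z).
  have := cong_mul (cong_refl _ x) (hde (y \\ z)).
  by rewrite !mul_ldivK.
have := cong_LMlt (GV _ (GM _ _ (DG _ Qh) (DG _ Da))) aha.
by rewrite [X in de _ X](sym_funK (h * a)).
Qed.

(** * The term condition in a quotient and modulo a congruence *)

Definition total_cong : congruence Q :=
  @Congruence Q (fun _ _ => True) (fun _ => I) (fun _ _ _ => I)
    (fun _ _ _ _ _ => I) (fun _ _ _ _ _ _ => I) (fun _ _ _ _ _ _ => I).

Lemma quot_rel_repr al be (X Y : quotient al) : (forall x y, al x y -> be x y) ->
  quot_rel be X Y <-> be (qrepr X) (qrepr Y).
Proof.
move=> albe; split=> [[x [y [-> -> xy]]]|XY].
  apply: cong_trans (cong_trans (albe _ _ (qrepr_class al x)) xy) _.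
  exact: cong_sym (albe _ _ (qrepr_class al y)).
by exists (qrepr X), (qrepr Y); rewrite !qreprK.
Qed.

Lemma eval_qclass al k (e : 'I_k -> Q) (t : lq_term k) :
  eval_term (fun i => qclass al (e i)) t = qclass al (eval_term e t).
Proof.
by elim: t => //= t1 -> t2 ->; rewrite (qclass_mul, qclass_ldiv).
Qed.

Lemma cons_env_qclass al k x (u : 'I_k -> Q) :
  cons_env (qclass al x) (fun i => qclass al (u i)) =
  fun i => qclass al (cons_env x u i).
Proof. by apply/funext => i; rewrite /cons_env; case: unlift. Qed.

(** A term evaluated at classes is the class of its value at representatives, so equality in the
    quotient becomes [al] on values in [Q]. *)
Lemma quot_centralizes al (A R : Q -> Q -> Prop)
    (A' R' : quotient al -> quotient al -> Prop) :
  (forall X Y, A' X Y <-> A (qrepr X) (qrepr Y)) ->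
  (forall X Y, R' X Y <-> R (qrepr X) (qrepr Y)) ->
  centralizes A R al -> centralizes A' R' eq.
Proof.
move=> AA' RR' ARal k t X Y U V /AA' XY UV.
rewrite -[X]qreprK -[Y]qreprK.
have -> : U = fun i => qclass al (qrepr (U i)) by apply/funext => i; rewrite qreprK.
have -> : V = fun i => qclass al (qrepr (V i)) by apply/funext => i; rewrite qreprK.
rewrite !cons_env_qclass !eval_qclass => /qclassP UVX; apply/qclassP.
by apply: (ARal _ _ _ _ _ _ XY) UVX => i; apply/RR'.
Qed.

Lemma centralizes_quot al (A R : Q -> Q -> Prop)
    (A' R' : quotient al -> quotient al -> Prop) :
  (forall x y, A x y -> A' (qclass al x) (qclass al y)) ->
  (forall x y, R x y -> R' (qclass al x) (qclass al y)) ->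
  centralizes A' R' eq -> centralizes A R al.
Proof.
move=> AA' RR' ARal k t x y u v /AA' xy uv /qclassP uvx; apply/qclassP.
move: uvx; rewrite -!eval_qclass -!cons_env_qclass.
by apply: ARal => // i; apply: RR'.
Qed.

Lemma central_cong_quot al be : (forall x y, al x y -> be x y) ->
  central_cong (@quot_rel Q al be) <-> centralizes be total_cong al.
Proof.
move=> albe; split; last by apply: quot_centralizes => // X Y; apply: quot_rel_repr.
by apply: centralizes_quot => // x y xy; exists x, y.
Qed.

Lemma abelian_cong_quot al be : (forall x y, al x y -> be x y) ->
  abelian_cong (@quot_rel Q al be) <-> centralizes be be al.
Proof.
move=> albe; split; first by apply: centralizes_quot => x y xy; exists x, y.
by apply: quot_centralizes => X Y; apply: quot_rel_repr.
Qed.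

(** * Lifts and stable normal subgroups *)

(** The graph of the endomorphism [h |-> h']. As a relation it is compatible with products and
    inverses for any [Q]; existence of lifts is left to the generators. *)
Definition lifts h g : Prop := forall x, L (h x) * h = g * L x.

Lemma lifts1 : lifts 1 1.
Proof. by move=> x; rewrite mul1g mulg1. Qed.

Lemma liftsM h1 h2 g1 g2 : lifts h1 g1 -> lifts h2 g2 -> lifts (h1 * h2) (g1 * g2).
Proof. by move=> hg1 hg2 x; rewrite -[RHS]mulgA -hg2 mulgA hg1 -mulgA. Qed.

Lemma liftsV h g : lifts h g -> lifts h^-1 g^-1.
Proof.
move=> hg x; apply: (can_inj (mulKg g)).
rewrite mulVKg mulgA -hg (_ : h (h^-1 x) = x) ?mulgK //.
exact: sym_invK.
Qed.

Lemma liftsJ h1 h2 g1 g2 : lifts h1 g1 -> lifts h2 g2 -> lifts (h1 ^ h2) (g1 ^ g2).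
Proof.
by move=> hg1 hg2; rewrite !conjgE; apply: liftsM (liftsV hg2) (liftsM hg1 hg2).
Qed.

Lemma liftsR h1 h2 g1 g2 :
  lifts h1 g1 -> lifts h2 g2 -> lifts [~ h1, h2] [~ g1, g2].
Proof.
by move=> hg1 hg2; rewrite !commgEl; apply: liftsM (liftsV hg1) (liftsJ hg1 hg2).
Qed.

Lemma lifts_subgroup N : is_subgroup N ->
  is_subgroup [set h | exists2 g, N g & lifts h g].
Proof.
move=> [N1 NM NV]; split=> [|h1 h2 [g1 Ng1 hg1] [g2 Ng2 hg2]|h [g Ng hg]].
- by exists 1 => //; apply: lifts1.
- by exists (g1 * g2); [apply: NM|apply: liftsM].
- by exists g^-1; [apply: NV|apply: liftsV].
Qed.

(** The lifting identity is applied at the point [h^-1 (g y)]. *)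
Lemma lifts_mul h h' g x y : lifts h h' ->
  h x * g y = (h' * (h^-1 * g) ^ (L x)^-1) (x * y).
Proof.
move=> hh'; have /(congr1 (fun f : sym Q => f (h^-1 (g y)))) /= := hh' x.
rewrite [h (h^-1 _)](sym_invK h) => ->.
by rewrite /= ldiv_mulK.
Qed.

Lemma lifts_ldiv h h' g x y : lifts h h' ->
  h x \\ g y = (h * (h'^-1 * g) ^ L x) (x \\ y).
Proof.
move=> hh'; apply: (can_inj (ldiv_mulK (h x))); rewrite mul_ldivK.
have /(congr1 (fun f : sym Q => f (((h'^-1 * g) ^ L x) (x \\ y)))) /= := hh' x.
move=> ->; rewrite !mul_ldivK.
by apply/esym/(sym_invK h').
Qed.

(** Normality and stability under lifting are what [lifts_mul] and [lifts_ldiv] require for the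
    orbits of [N] to form a congruence. *)
Definition admissible N : Prop :=
  is_normal_in (LMlt Q) N /\ forall h, N h -> exists2 g, N g & lifts h g.

Lemma admissible_commutator N M :
  admissible N -> admissible M -> admissible (commutator_subgroup N M).
Proof.
move=> [Nnormal Nlift] [Mnormal Mlift]; split; first exact: commutator_normal.
apply: commutator_sub => [|h g Nh Mg].
  exact: lifts_subgroup (generated_subgroup _).
have [h' Nh' hh'] := Nlift h Nh; have [g' Mg' gg'] := Mlift g Mg.
by exists [~ h', g']; [apply: mem_commutator|apply: liftsR].
Qed.

(** * Orbit congruences *)

Definition orbit_rel N x y : Prop := exists2 h, N h & y = h x.

Lemma orbit_refl N x : is_subgroup N -> orbit_rel N x x.
Proof. by move=> [N1 _ _]; exists 1. Qed.

Lemma orbit_sym N x y : is_subgroup N -> orbit_rel N x y -> orbit_rel N y x.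
Proof.
move=> [_ _ NV] [h Nh ->]; exists h^-1; first exact: NV.
exact/esym/(sym_funK h).
Qed.

Lemma orbit_trans N x y z :
  is_subgroup N -> orbit_rel N x y -> orbit_rel N y z -> orbit_rel N x z.
Proof.
by move=> [_ NM _] [h Nh ->] [g Ng ->]; exists (g * h); first exact: NM.
Qed.

Lemma orbit_mul N x x' y y' : admissible N ->
  orbit_rel N x x' -> orbit_rel N y y' -> orbit_rel N (x * y) (x' * y').
Proof.
move=> [[[_ NM NV] _ NJ] Nlift] [h Nh ->] [g Ng ->].
have [h' Nh' hh'] := Nlift h Nh; have [_ _ GV] := LMlt_subgroup.
exists (h' * (h^-1 * g) ^ (L x)^-1); last exact: lifts_mul.
exact: NM Nh' (NJ _ _ (NM _ _ (NV _ Nh) Ng) (GV _ (LMlt_ltransl x))).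
Qed.

Lemma orbit_ldiv N x x' y y' : admissible N ->
  orbit_rel N x x' -> orbit_rel N y y' -> orbit_rel N (x \\ y) (x' \\ y').
Proof.
move=> [[[_ NM NV] _ NJ] Nlift] [h Nh ->] [g Ng ->].
have [h' Nh' hh'] := Nlift h Nh.
exists (h * (h'^-1 * g) ^ L x); last exact: lifts_ldiv.
exact: NM Nh (NJ _ _ (NM _ _ (NV _ Nh') Ng) (LMlt_ltransl x)).
Qed.

Definition orbit_cong N (adm : admissible N) : congruence Q :=
  let grp := let: conj (And3 grp _ _) _ := adm in grp in
  Congruence (fun x => orbit_refl x grp) (fun x y => @orbit_sym N x y grp)
    (fun x y z => @orbit_trans N x y z grp)
    (fun x x' y y' => @orbit_mul N x x' y y' adm)
    (fun x x' y y' => @orbit_ldiv N x x' y y' adm).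

(** * The term condition for orbits *)

(* The [N]-component of a term operation depends on the [N]-components of its
   arguments only, up to [M] and within a [be]-block. *)
Lemma orbit_eval_term N M be k (t : lq_term k) (e e' : 'I_k -> Q)
    (n : 'I_k -> sym Q) : admissible N -> admissible M ->
  (forall x y h, be x y -> N h -> M [~ h, (L x)^-1 * L y]) ->
  (forall i, N (n i)) -> (forall i, be (e i) (e' i)) ->
  exists g, [/\ N g,
    orbit_rel M (g (eval_term e t)) (eval_term (fun i => n i (e i)) t) &
    orbit_rel M (g (eval_term e' t)) (eval_term (fun i => n i (e' i)) t)].
Proof.
move=> admN admM NbeM Nn ee'.
have [[[_ NM NV] NG NJ] Nlift] := admN.
have [[Mgrp MG MJ] _] := admM; have [M1 MM MV] := Mgrp.
have [_ GM GV] := LMlt_subgroup.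
(* Replacing [h1] by an element congruent to it modulo [M] moves the value only within its
   [M]-orbit. *)
have orbit_conj g h1 h2 x : N g -> N h1 -> M (h1^-1 * h2) ->
    orbit_rel M ((g * h1) x) ((g * h2) x).
  move=> Ng Nh1 Mh; exists ((h1^-1 * h2) ^ (g * h1)^-1).
    exact: MJ _ _ Mh (GV _ (NG _ (NM _ _ Ng Nh1))).
  rewrite conjgE invgK.
  change (g (h2 x) = g (h1 (h1^-1 (h2 ((g * h1)^-1 ((g * h1) x)))))).
  by rewrite [(g * h1)^-1 _](sym_funK (g * h1)) [h1 (h1^-1 _)](sym_invK h1).
(* The commutator hypothesis, restated: conjugations by [L x] and [L y], or by their inverses, agree
   on [N] modulo [M]. *)
have conjV x y h : be x y -> N h -> M ((h ^ (L x)^-1)^-1 * h ^ (L y)^-1).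
  move=> xy Nh; have := MJ _ _ (NbeM _ _ _ (cong_sym xy) Nh) (GV _ (LMlt_ltransl x)).
  by rewrite commgEl conjMg conjVg -conjgM mulgK.
have conj x y h : be x y -> N h -> M ((h ^ L x)^-1 * h ^ L y).
  move=> xy Nh; have := NbeM _ _ _ xy (NJ _ _ Nh (LMlt_ltransl x)).
  by rewrite commgEl -conjgM mulVKg.
pose om := orbit_cong admM.
have ev_be s : be (eval_term e s) (eval_term e' s).
  by elim: s => //= s1 IH1 s2 IH2; [apply: cong_mul|apply: cong_ldiv].
elim: t => [i|t1 [g1 [Ng1 gt1 gt1']] t2 [g2 [Ng2 gt2 gt2']]
           |t1 [g1 [Ng1 gt1 gt1']] t2 [g2 [Ng2 gt2 gt2']]] /=.
- by exists (n i); split; first exact: Nn; apply: orbit_refl.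
- have [h Nh lift_h] := Nlift _ Ng1; set x := eval_term e t1.
  have Ng12 := NM _ _ (NV _ Ng1) Ng2.
  have Nc := NJ _ _ Ng12 (GV _ (LMlt_ltransl x)).
  (* The element given by [lifts_mul] for the values at [e]. At [e'] the formula conjugates by
     another translation, and [conjV] absorbs the difference. *)
  exists (h * (g1^-1 * g2) ^ (L x)^-1); split; first exact: NM.
    rewrite -(lifts_mul _ _ _ lift_h); exact: (cong_mul (c := om) gt1 gt2).
  apply: (cong_trans (c := om)); last exact: (cong_mul (c := om) gt1' gt2').
  rewrite (lifts_mul _ _ _ lift_h); apply: orbit_conj => //; exact: conjV (ev_be t1) Ng12.
- have [h Nh lift_h] := Nlift _ Ng1; set x := eval_term e t1.
  have Ng12 := NM _ _ (NV _ Nh) Ng2.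
  have Nc := NJ _ _ Ng12 (LMlt_ltransl x).
  exists (g1 * (h^-1 * g2) ^ L x); split; first exact: NM.
    rewrite -(lifts_ldiv _ _ _ lift_h); exact: (cong_ldiv (c := om) gt1 gt2).
  apply: (cong_trans (c := om)); last exact: (cong_ldiv (c := om) gt1' gt2').
  rewrite (lifts_ldiv _ _ _ lift_h); apply: orbit_conj => //; exact: conj (ev_be t1) Ng12.
Qed.

Lemma orbit_centralizes N M be : admissible N -> admissible M ->
  (forall x y h, be x y -> N h -> M [~ h, (L x)^-1 * L y]) ->
  centralizes (orbit_rel N) be (orbit_rel M).
Proof.
move=> admN admM NbeM k t x y u v [h Nh ->] uv.
have N1 : N 1 by have [[[]]] := admN.
(* Only the distinguished variable is displaced. As [u] and [v] are [be]-related, a single [g] then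
   serves both parameter lists. *)
pose n (i : 'I_k.+1) : sym Q := if unlift ord0 i is Some _ then 1 else h.
have Nn (i : 'I_k.+1) : N (n i) by rewrite /n; case: unlift.
have nE w : (fun i => n i (cons_env x w i)) = cons_env (h x) w.
  by apply/funext => i; rewrite /n /cons_env; case: unlift.
have xuv i : be (cons_env x u i) (cons_env x v i).
  by rewrite /cons_env; case: unlift => [j|]; [apply: uv|apply: cong_refl].
have [g [Ng]] := orbit_eval_term t admN admM NbeM Nn xuv.
rewrite !nE => gu gv tuv; pose om := orbit_cong admM.
apply: (cong_trans (c := om)) gv; apply: (cong_trans (c := om)) (cong_sym (c := om) gu) _.
by have [[_ NG _] _] := admN; apply: (cong_LMlt (al := om)) (NG _ Ng) tuv.
Qed.

(** * The displacement group in the semimedial case *)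

Section Semimedial.
Hypothesis Q_semimedial : semimedial Q.

Lemma lifts_ltransl x : lifts (L x) (L (x * x)).
Proof. by move=> y; apply: sym_eqP; apply/funext => z; rewrite /= Q_semimedial. Qed.

Lemma LMlt_lifts h : LMlt Q h -> exists2 g, LMlt Q g & lifts h g.
Proof.
move: h; apply: smallest_sub; first exact: lifts_subgroup LMlt_subgroup.
move=> _ [x _ <-]; exists (L (x * x)); first exact: LMlt_ltransl.
exact: lifts_ltransl.
Qed.

(** The generator [L x / L y] lifts to [L (x * x) / L (y * y)], again in [Dis Q], and lifts of
    conjugates are conjugates of lifts. *)
Lemma admissible_Dis : admissible (Dis Q).
Proof.
have [Dgrp DG DJ] := Dis_normal.
split; first exact: Dis_normal.
suff sub : Dis Q `<=`
  [set h | Dis Q h /\ exists2 g, Dis Q g & lifts h g] by move=> h /sub[].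
apply: smallest_sub; last first.
  move=> _ [x _ [y _ <-]].
  have Dxy u v : Dis Q (L u / L v) by rewrite Dis_total; apply: mem_Dis_of.
  split=> //; exists (L (x * x) / L (y * y)) => //.
  by apply: liftsM (liftsV _); apply: lifts_ltransl.
split=> [|h [/DG]//|h g [Dh [h' Dh' hh']] Gg].
  have [D1 DM DV] := Dgrp; have [E1 EM EV] := lifts_subgroup Dgrp.
  split=> [|h g [Dh Eh] [Dg Eg]|h [Dh Eh]]; first by [].
    by split; [apply: DM|apply: EM].
  by split; [apply: DV|apply: EV].
split; first exact: DJ.
have [g' Gg' gg'] := LMlt_lifts Gg.
by exists (h' ^ g'); [apply: DJ|apply: liftsJ].
Qed.

(** For a generator [a = L x / L y], the products [a * h] and [h * a] differ on the left by factors
    [d z = L (k z) / L z]; these lie in [Dis_of al] because [k] moves points within [al]-classes. *)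
Lemma kernel_commutator al h g :
  cong_kernel al h -> Dis Q g -> Dis_of al [~ h, g].
Proof.
have [_ AG AJ] := Dis_of_normal al; have [[_ AM AV] _ _] := Dis_of_normal al.
(* Inverting the commutator puts the factor from [Dis Q] first, so that it can be reduced to a
   generator. *)
move=> Kh Dg; rewrite -invgR; apply: (AV); move: Dg Kh; rewrite Dis_total.
apply: (commutator_normal_closure_sub LMlt_subgroup _ (cong_kernel_normal al)
  (Dis_of_normal al)).
  by move=> _ [x [y [_ ->]]]; apply: LMlt_ltransl_div.
move=> {h g} _ h [x [y [_ ->]]] Kh.
have [_ KG KJ] := cong_kernel_normal al.
(* This conjugate makes [a * h] and [h] equal to [L z * (k / L y)] for [z = x] and [z = y]
   respectively. *)
have [Dk kal] := KJ _ _ Kh (LMlt_ltransl y); set k := h ^ L y in Dk kal.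
have kLV : (L y)^-1 * h = k / L y by rewrite /k conjgE -mulgA mulgK.
clearbody k.
have [_ DG _] := Dis_normal.
have [k' _ kk'] := LMlt_lifts (DG _ Dk).
have [_ GM GV] := LMlt_subgroup.
pose d z := L (k z) / L z; set a := L x / L y.
have dk z : d z * (L z * (k / L y)) = k' * (L z / L y).
  by rewrite /d divgKA !mulgA kk'.
(* By [dk] both sides equal [k' * a]. *)
have dah : d x * (a * h) = d y * (h * a).
  have -> : a * h = L x * (k / L y) by rewrite -kLV mulgA.
  have -> : h = L y * (k / L y) by rewrite -kLV mulVKg.
  by rewrite dk [RHS]mulgA dk mulgV mulg1.
have -> : [~ a, h] = ((d x)^-1 * d y) ^ (h * a).
  by rewrite conjgE -[(d x)^-1 * _ * _]mulgA -dah mulKg invgM -mulgA.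
have Ad z : Dis_of al (d z) by apply: mem_Dis_of (kal z).
apply: AJ; first exact: AM _ _ (AV _ (Ad x)) (Ad y).
exact: GM _ _ (KG _ Kh) (LMlt_ltransl_div x y).
Qed.

(** The left factor is arbitrary because [L x' / L x] lies in [Dis Q] and sends [x * y] to
    [x' * y]. *)
Lemma orbit_Dis_divr x x' y y' :
  orbit_rel (Dis Q) y y' -> orbit_rel (Dis Q) (x * y) (x' * y').
Proof.
move=> yy'; apply: orbit_trans (orbit_mul admissible_Dis (orbit_refl x _) yy') _;
  try by case: Dis_normal.
exists (L x' / L x); first by rewrite Dis_total; apply: mem_Dis_of.
by rewrite /= ldiv_mulK.
Qed.

Lemma orbit_Dis_ldivr x x' y y' :
  orbit_rel (Dis Q) y y' -> orbit_rel (Dis Q) (x \\ y) (x' \\ y').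
Proof.
move=> yy'; apply: orbit_trans (orbit_ldiv admissible_Dis (orbit_refl x _) yy') _;
  try by case: Dis_normal.
exists ((L x')^-1 * L x); first exact: Dis_ltransl_divl.
by rewrite /= mul_ldivK.
Qed.

(* Modulo the orbits of [Dis Q], every term operation depends on one variable. *)
Lemma total_centralizes_Dis :
  centralizes total_cong total_cong (orbit_rel (Dis Q)).
Proof.
move=> k t x y u v _ _ tuv; pose om := orbit_cong admissible_Dis.
(* The first case arises when the rightmost leaf of [t] is the distinguished variable, the second
   when it is a parameter. *)
have [t_x|t_u] : (forall x u v, om (eval_term (cons_env x u) t)
                                  (eval_term (cons_env x v) t)) \/
    (forall x y u, om (eval_term (cons_env x u) t) (eval_term (cons_env y u) t)).
- move=> {x y u v tuv}; elim: t => [i|s _ t IHt|s _ t IHt] /=.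
  + case: (unliftP ord0 i) => [j|] ->; [right|left] => ? ? ?.
      by rewrite !cons_env_lift; apply: (cong_refl om).
    by rewrite !cons_env_ord0; apply: (cong_refl om).
  + by case: IHt => IHt; [left|right] => *; apply: orbit_Dis_divr; apply: IHt.
  + by case: IHt => IHt; [left|right] => *; apply: orbit_Dis_ldivr; apply: IHt.
- exact: t_x.
- apply: (cong_trans (c := om)) (t_u x y v).
  exact: (cong_trans (c := om)) (t_u y x u) tuv.
Qed.

(** * Congruence chains from series of [Dis Q] *)

Lemma orbit_cong_chain (P : forall R : leftQuasigroupType, (R -> R -> Prop) -> Prop)
    (N : nat -> set (sym Q)) n (admN : forall i, admissible (N i)) :
  N 0%N = Dis Q -> N n = [set 1] -> (forall i, N i.+1 `<=` N i) ->
  P _ (@quot_rel Q (orbit_cong (admN 0%N)) total_cong) ->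
  (forall i, P _ (@quot_rel Q (orbit_cong (admN i.+1)) (orbit_cong (admN i)))) ->
  cong_chain Q P n.+1.
Proof.
move=> N0 Nn Nsub Ptop Pstep.
(* The series is reversed: [al 0] is the orbit relation of the trivial group, [al n] that of
   [Dis Q], and [al n.+1] is total, which costs the extra step. *)
pose al i := if (i <= n)%N then orbit_cong (admN (n - i)%N) else total_cong.
have al_last : al n.+1 = total_cong by rewrite /al ltnn.
have al_n : al n = orbit_cong (admN 0%N) by rewrite /al leqnn subnn.
have al_lt i : (i < n)%N -> exists j,
    al i = orbit_cong (admN j.+1) /\ al i.+1 = orbit_cong (admN j).
  move=> i_n; exists (n - i.+1)%N.
  by rewrite /al i_n (ltnW i_n) (subnSK i_n).
exists al; split.
- move=> x y; rewrite /al subn0 /= /orbit_rel Nn.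
  by split=> [[h -> ->]//|->]; exists 1.
- by rewrite al_last.
- move=> i; rewrite ltnS leq_eqVlt => /predU1P[->|/al_lt[j [-> ->]]] x y.
    by rewrite al_last.
  by move=> [h /Nsub Nh ->]; exists h.
- move=> i; rewrite ltnS leq_eqVlt => /predU1P[->|/al_lt[j [-> ->]]].
    by rewrite al_n al_last.
  exact: Pstep.
Qed.

Lemma commutator_subl N M : admissible N -> admissible M ->
  commutator_subgroup N M `<=` N.
Proof.
move=> [[Ngrp NG NJ] _] [[_ MG _] _]; apply: commutator_sub => // h g Nh Mg.
have [_ NM NV] := Ngrp; rewrite commgEl.
exact: NM (NV _ Nh) (NJ _ _ Nh (MG _ Mg)).
Qed.

Lemma admissible_lower_central i : admissible (lower_central (Dis Q) i).
Proof.
elim: i => [|i IHi]; first exact: admissible_Dis.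
exact: admissible_commutator IHi admissible_Dis.
Qed.

Lemma admissible_derived i : admissible (derived (Dis Q) i).
Proof.
by elim: i => [|i IHi]; [apply: admissible_Dis|apply: admissible_commutator].
Qed.

Lemma lower_central_chain n : lower_central (Dis Q) n = [set 1] ->
  cong_chain Q central_cong n.+1.
Proof.
move=> Dn; have Dsub i : lower_central (Dis Q) i.+1 `<=` lower_central (Dis Q) i.
  exact: commutator_subl (admissible_lower_central i) admissible_Dis.
apply: (orbit_cong_chain (admN := admissible_lower_central)) => //.
  apply/central_cong_quot => //; exact: total_centralizes_Dis.
move=> i; apply/central_cong_quot => [x y [h /Dsub Dh ->]|]; first by exists h.
apply: orbit_centralizes => [||x y h _ Dh]; try exact: admissible_lower_central.
exact: mem_commutator Dh (Dis_ltransl_divl x y).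
Qed.

Lemma derived_chain n : derived (Dis Q) n = [set 1] ->
  cong_chain Q abelian_cong n.+1.
Proof.
move=> Dn; have Dsub i : derived (Dis Q) i.+1 `<=` derived (Dis Q) i.
  by apply: commutator_subl; apply: admissible_derived.
apply: (orbit_cong_chain (admN := admissible_derived)) => //.
  apply/abelian_cong_quot => //; exact: total_centralizes_Dis.
move=> i; apply/abelian_cong_quot => [x y [h /Dsub Dh ->]|]; first by exists h.
apply: orbit_centralizes => [||x _ h [g Dg ->] Dh]; try exact: admissible_derived.
apply: mem_commutator => //.
have [[[_ DM DV] _ DJ] Dlift] := admissible_derived i.
have [g' Dg' gg'] := Dlift _ Dg.
(* Within an orbit of the derived subgroup, the lift [g'] of [g] shows that [(L x)^-1 * L (g x)]
   stays in that subgroup, so its commutator with [h] lies in the next term. *)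
have -> : (L x)^-1 * L (g x) = g' ^ L x * g^-1.
  by rewrite conjgE -gg' !mulgA mulgK.
exact: DM (DJ _ _ Dg' (LMlt_ltransl x)) (DV _ Dg).
Qed.

(** * Series of [Dis Q] from congruence chains *)

(* The descending series runs through [Dis Q], the kernel of [al n.-1],
   [Dis_of (al n.-1)], the kernel of [al n.-2], and so on down to the kernel of
   [al 0], which is trivial: one step at the top and two for each further [al i]. *)
Lemma displacement_series (al : nat -> congruence Q) n
    (C : set (sym Q) -> set (sym Q)) :
  (1 <= n)%N -> (forall x y, al 0%N x y <-> x = y) -> (forall x y, al n x y) ->
  (forall X, C X 1) ->
  (forall i X, (i < n)%N ->
     X `<=` Dis_of (al i.+1) -> C X `<=` cong_kernel (al i)) ->
  (forall i X, X `<=` cong_kernel (al i) -> C X `<=` Dis_of (al i)) ->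
  iter (2 * n - 1) C (Dis Q) = [set 1].
Proof.
case: n => // n _ al0 alT C1 Cstep Ckernel.
(* Here [n] is the predecessor of the chain length, so the exponent is [2 * n + 1]; at [j = n] the
   kernel of [al 0] is trivial. *)
suff sub j : (j <= n)%N ->
    iter (2 * j).+1 C (Dis Q) `<=` cong_kernel (al (n - j)%N).
  have -> : (2 * n.+1 - 1)%N = (2 * n).+1 by rewrite mulnS.
  apply/seteqP; split=> [h /(sub n (leqnn n))|_ ->]; last exact: C1.
  by rewrite subnn (cong_kernel_eq al0).
elim: j => [_|j IHj j_n].
  (* Since [al n.+1] is total, [Dis Q] is contained in its relative displacement group, and a single
     step reaches the first kernel. *)
  rewrite subn0; apply: Cstep => //; rewrite Dis_total.
  apply: sub_smallest2r; first exact: Dis_of_normal.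
  by move=> _ [x [y [_ ->]]]; exists x, y.
rewrite mulnS !addSn iterS; apply: Cstep; first by rewrite ltnS leq_subr.
rewrite subnSK // iterS; apply: Ckernel; exact: IHj (ltnW j_n).
Qed.

Lemma central_chain_lower_central n : (1 <= n)%N ->
  cong_chain Q central_cong n -> lower_central (Dis Q) (2 * n - 1) = [set 1].
Proof.
move=> n_gt0 [al [al0 alT al_le alP]].
have [Dgrp _ _] := Dis_normal.
apply: (displacement_series n_gt0 al0 alT) => [X|i X i_n XD|i X XK].
- by have [] := generated_subgroup [set [~ h, k] | h in X & k in Dis Q].
- have [Kgrp _ _] := cong_kernel_normal (al i).
  apply: commutator_sub => // h g /XD Xh; rewrite Dis_total.
  apply: (centralizes_commutator (be := total_cong)) Xh.
  exact/(central_cong_quot (al_le i i_n))/alP.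
- have [Agrp _ _] := Dis_of_normal (al i).
  by apply: commutator_sub => // h g /XK Xh Dg; apply: kernel_commutator.
Qed.

Lemma abelian_chain_derived n : (1 <= n)%N ->
  cong_chain Q abelian_cong n -> derived (Dis Q) (2 * n - 1) = [set 1].
Proof.
move=> n_gt0 [al [al0 alT al_le alP]].
apply: (displacement_series n_gt0 al0 alT) => [X|i X i_n XD|i X XK].
- by have [] := generated_subgroup [set [~ h, k] | h in X & k in X].
- have [Kgrp _ _] := cong_kernel_normal (al i).
  apply: commutator_sub => // h g /XD Xh /XD Xg.
  apply: centralizes_commutator Xh Xg.
  exact/(abelian_cong_quot (al_le i i_n))/alP.
- have [Agrp _ _] := Dis_of_normal (al i).
  (* Elements of the kernel lie in [Dis Q], so [[K, K]] is contained in [[K, Dis Q]]. *)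
  apply: commutator_sub => // h g /XK Kh /XK[Dg _].
  exact: kernel_commutator.
Qed.

End Semimedial.

End Displacements.

Theorem lemma3p4 (Q : leftQuasigroupType) (n : nat)
    (Q_semimedial : semimedial Q) (n_ge1 : (1 <= n)%N) :
  ((group_nilpotent_length (Dis Q) n ->
      exists2 m : nat, (m <= n + 1)%N & lq_nilpotent_length Q m)
   /\
   (group_solvable_length (Dis Q) n ->
      exists2 m : nat, (m <= n + 1)%N & lq_solvable_length Q m))
  /\
  ((lq_nilpotent_length Q n ->
      exists2 m : nat, (m <= 2 * n - 1)%N & group_nilpotent_length (Dis Q) m)
   /\
   (lq_solvable_length Q n ->
      exists2 m : nat, (m <= 2 * n - 1)%N & group_solvable_length (Dis Q) m)).
Proof.
(* Of the given length only existence is kept; the bounding series or chain then yields a minimum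
   below it. *)
split; split=> -[len_n _]; apply: least_nat_exists; rewrite ?addn1.
- exact: lower_central_chain.
- exact: derived_chain.
- exact: central_chain_lower_central.
- exact: abelian_chain_derived.
Qed.
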